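(* For a skew shape $\lambda/\mu$, the tropical polynomial $\mathrm{Trop}(s_{\lambda/\mu}(x_1,\dots,x_n))$ has at most $O(n^2\cdot\lambda_1)$ tropical semiring complexity.
   Context: Partitions are identified with their Ferrers/Young diagrams; $\lambda_1$ denotes the first part of $\lambda$. For partitions $\mu\subseteq\lambda$, the skew-Schur polynomial is $s_{\lambda/\mu}(x_1,\dots,x_n)=\sum_T x^T$, the generating series over semistandard tableaux $T$ of skew shape $\lambda/\mu$ with entries in $\{1,\dots,n\}$, where $x^T=\prod_i x_i^{\#i\text{'s in }T}$. The tropical semiring $(\mathbb{R},\oplus,\odot)$ has operations $a\oplus b=\max(a,b)$ and $a\odot b=a+b$. The tropicalization (with respect to the trivial valuation) of $f=\sum c_{i_1,\dots,i_n}x_1^{i_1}\cdots x_n^{i_n}\in\mathbb{C}[x_1,\dots,x_n]$ is the tropical polynomial $$\mathrm{Trop}(f)=\max\{i_1x_1+\cdots+i_nx_n : c_{i_1,\dots,i_n}\ne 0\}.$$ An arithmetic circuit is a circuit whose inputs are each labelled by a single variable $x_i$ or a fixed constant, in which each gate performs a single $\oplus$ or $\odot$ operation, and which has one output. A circuit $C$ gives an expression $\mathrm{res}(C)$, the tropical polynomial in $x_1,\dots,x_n$ that it computes. The circuit $C$ evaluates a tropical polynomial $g$ if $\mathrm{res}(C)=g$ as tropical polynomials, meaning that one can show $\mathrm{res}(C)=g$ using the semiring axioms together with the idempotence property $a\oplus a=a$. The tropical semiring complexity of $g$ is the smallest number of gates in a circuit evaluating $g$. *)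

(* Defs.v *)
From HB Require Import structures.
From mathcomp Require Import all_boot all_order all_algebra.
From mathcomp Require Import mpoly complex reals.

Set Implicit Arguments.
Unset Strict Implicit.
Unset Printing Implicit Defensive.

Import Order.TTheory GRing.Theory Num.Theory.

Local Open Scope ring_scope.

(* Rows and columns are numbered from 0, and the entries {1, ..., n} of a
   tableau are represented by 'I_n; the variable x_(i+1) is 'X_i. *)

Section SkewSchur.

Definition is_partition (la : seq nat) : bool :=
  sorted geq la && (0%N \notin la).

Definition first_part (la : seq nat) : nat := head 0%N la.

Definition skew_shape (la mu : seq nat) : Prop :=
  [/\ is_partition la, is_partition mu &
      forall i, (nth 0 mu i <= nth 0 la i)%N].

Definition in_skew (la mu : seq nat)
    (c : 'I_(size la) * 'I_(first_part la)) : bool :=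
  (nth 0 mu c.1 <= c.2 < nth 0 la c.1)%N.

Definition skew_box (la mu : seq nat) : finType :=
  {c : 'I_(size la) * 'I_(first_part la) | in_skew mu c}.

Variables (n : nat) (la mu : seq nat).

Definition filling : finType := {ffun skew_box la mu -> 'I_n}.

Definition box_row (b : skew_box la mu) : nat := (val b).1.
Definition box_col (b : skew_box la mu) : nat := (val b).2.

Definition semistandard (T : filling) : bool :=
  [forall b, forall b',
     ((box_row b == box_row b') && (box_col b < box_col b')
        ==> (T b <= T b'))
  && ((box_col b == box_col b') && (box_row b < box_row b')
        ==> (T b < T b'))]%N.

Definition skew_schur (K : comNzRingType) : {mpoly K[n]} :=
  \sum_(T : filling | semistandard T)
     \prod_(i < n) 'X_i ^+ #|[set b | T b == i]|.

End SkewSchur.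

Section Tropical.

Variables (R : realType) (n : nat).

(* Elements of the max-plus semiring; None is its zero -oo, which is needed
   because Trop 0 is a maximum over the empty set. *)
Definition tnum : Type := option R.

Definition tnum_add (a b : tnum) : tnum :=
  match a, b with
  | Some x, Some y => Some (Num.max x y)
  | Some x, None => Some x
  | None, _ => b
  end.

Definition tnum_mul (a b : tnum) : tnum :=
  match a, b with
  | Some x, Some y => Some (x + y)
  | _, _ => None
  end.

Inductive texpr : Type :=
  | TVar of 'I_n
  | TConst of tnum
  | TAdd of texpr & texpr
  | TMul of texpr & texpr.

Definition TZero : texpr := TConst None.
Definition TOne : texpr := TConst (Some 0).

(* Equality of tropical polynomials: provability from the commutative semiring
   axioms, idempotence and evaluation of constants. It is finer than equality
   of the associated functions R^n -> R. *)
Inductive teq : texpr -> texpr -> Prop :=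
  | teq_refl a : teq a a
  | teq_sym a b : teq a b -> teq b a
  | teq_trans a b c : teq a b -> teq b c -> teq a c
  | teq_add a a' b b' : teq a a' -> teq b b' -> teq (TAdd a b) (TAdd a' b')
  | teq_mul a a' b b' : teq a a' -> teq b b' -> teq (TMul a b) (TMul a' b')
  | teq_addA a b c : teq (TAdd a (TAdd b c)) (TAdd (TAdd a b) c)
  | teq_addC a b : teq (TAdd a b) (TAdd b a)
  | teq_add0 a : teq (TAdd TZero a) a
  | teq_mulA a b c : teq (TMul a (TMul b c)) (TMul (TMul a b) c)
  | teq_mulC a b : teq (TMul a b) (TMul b a)
  | teq_mul1 a : teq (TMul TOne a) a
  | teq_mul0 a : teq (TMul TZero a) TZero
  | teq_mulDr a b c : teq (TMul a (TAdd b c)) (TAdd (TMul a b) (TMul a c))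
  | teq_addxx a : teq (TAdd a a) a
  | teq_constD c d : teq (TAdd (TConst c) (TConst d)) (TConst (tnum_add c d))
  | teq_constM c d : teq (TMul (TConst c) (TConst d)) (TConst (tnum_mul c d)).

(* The linear form i_1 x_1 + ... + i_n x_n. *)
Definition tmonomial (m : 'X_{1..n}) : texpr :=
  \big[TMul/TOne]_(i < n) iter (m i) (TMul (TVar i)) TOne.

Definition Trop (K : nzRingType) (f : {mpoly K[n]}) : texpr :=
  \big[TAdd/TZero]_(m <- msupp f) tmonomial m.

(* A circuit is a straight-line program: an operand is an input (a variable or
   a constant) or the result of the k-th gate. Inputs are not gates. *)
Inductive operand : Type :=
  | InVar of 'I_n
  | InConst of tnum
  | OfGate of nat.

Inductive gate : Type :=
  | GAdd of operand & operand
  | GMul of operand & operand.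

Definition operand_before (k : nat) (w : operand) : bool :=
  if w is OfGate j then (j < k)%N else true.

Definition gate_before (k : nat) (g : gate) : bool :=
  match g with
  | GAdd u v | GMul u v => operand_before k u && operand_before k v
  end.

Fixpoint gates_wf (k : nat) (gs : seq gate) : bool :=
  if gs is g :: gs' then gate_before k g && gates_wf k.+1 gs' else true.

Record circuit : Type := Circuit {
  gates : seq gate;
  output : operand;
  circuit_wf : gates_wf 0 gates && operand_before (size gates) output
}.

Definition operand_res (vals : seq texpr) (w : operand) : texpr :=
  match w with
  | InVar i => TVar i
  | InConst c => TConst c
  | OfGate k => nth TZero vals k
  end.

Definition gate_res (vals : seq texpr) (g : gate) : texpr :=
  match g with
  | GAdd u v => TAdd (operand_res vals u) (operand_res vals v)
  | GMul u v => TMul (operand_res vals u) (operand_res vals v)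
  end.

Definition res (C : circuit) : texpr :=
  operand_res
    (foldl (fun vals g => rcons vals (gate_res vals g)) [::] (gates C))
    (output C).

Definition evaluates (C : circuit) (g : texpr) : Prop := teq (res C) g.

Definition num_gates (C : circuit) : nat := size (gates C).

Definition tropical_complexity (g : texpr) (k : nat) : Prop :=
  (exists2 C, evaluates C g & num_gates C = k) /\
  (forall C, evaluates C g -> (k <= num_gates C)%N).

End Tropical.

(* Main.v *)
(* Let [c_j] be the number of boxes in column [j] of the skew shape. The support
   of [s_(la/mu)] equals that of [\prod_j e_(c_j)], so by idempotence its
   tropicalization is the tropical product of the [Trop (e_(c_j))]. One
   inclusion reads off the columns of a semistandard tableau. Conversely, among the
   column-strict fillings with a given content, one maximizing
   [\sum_b column(b) * entry(b)] is semistandard: a descent along a row would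
   allow a swap of entries between the two columns that increases this weight.
   The recursion [e_k(x_1..x_i) = e_k(x_1..x_(i-1)) + x_i e_(k-1)(x_1..x_(i-1))]
   computes all [e_k] with [2 n^2] gates, and [la_1] further gates multiply. *)

Require Import Defs.
From mathcomp Require Import all_boot all_order all_algebra.
From mathcomp Require Import mpoly complex reals.
From mathcomp Require Import boolp zify.
From Stdlib Require Import Setoid Morphisms.

Set Implicit Arguments.
Unset Strict Implicit.
Unset Printing Implicit Defensive.

Import Order.TTheory GRing.Theory Num.Theory.

(** * Tropical sums of monomials up to provable equality *)

Section TropicalSums.

Variables (R : realType) (n : nat).
Local Notation texpr := (texpr R n).
Local Notation mon := 'X_{1..n}.

#[local] Instance teq_equivalence : Equivalence (@teq R n).
Proof.
split; [exact: teq_refl | exact: teq_sym | exact: teq_trans].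
Qed.

#[local] Hint Resolve teq_refl : core.

#[local] Instance TAdd_proper :
  Proper (@teq R n ==> @teq R n ==> @teq R n) (@TAdd R n).
Proof. by move=> a a' ha b b' hb; apply: teq_add. Qed.

#[local] Instance TMul_proper :
  Proper (@teq R n ==> @teq R n ==> @teq R n) (@TMul R n).
Proof. by move=> a a' ha b b' hb; apply: teq_mul. Qed.

Lemma teq_addr0 (a : texpr) : teq (TAdd a (TZero R n)) a.
Proof. by rewrite teq_addC; apply: teq_add0. Qed.

Lemma teq_mulr1 (a : texpr) : teq (TMul a (TOne R n)) a.
Proof. by rewrite teq_mulC; apply: teq_mul1. Qed.

Lemma teq_mulr0 (a : texpr) : teq (TMul a (TZero R n)) (TZero R n).
Proof. by rewrite teq_mulC; apply: teq_mul0. Qed.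

Lemma teq_mulDl (a b c : texpr) :
  teq (TMul (TAdd a b) c) (TAdd (TMul a c) (TMul b c)).
Proof.
by rewrite teq_mulC teq_mulDr (teq_mulC c a) (teq_mulC c b).
Qed.

Lemma teq_mulACA (a b c d : texpr) :
  teq (TMul (TMul a b) (TMul c d)) (TMul (TMul a c) (TMul b d)).
Proof.
by rewrite -teq_mulA (teq_mulA b) (teq_mulC b c) -(teq_mulA c) teq_mulA.
Qed.

(** Tropical polynomials are handled as lists of exponents, repetitions allowed; [Trop R f] unfolds
    to [tsum (msupp f)]. *)
Definition tsum (ms : seq mon) : texpr :=
  \big[@TAdd R n/TZero R n]_(m <- ms) tmonomial R m.

Lemma tsum_cat ms1 ms2 :
  teq (tsum (ms1 ++ ms2)) (TAdd (tsum ms1) (tsum ms2)).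
Proof.
rewrite /tsum; elim: ms1 => [|m ms1 IH] /=.
  by rewrite big_nil teq_add0.
by rewrite !big_cons IH teq_addA.
Qed.

(** This is where idempotence enters: associativity and commutativity bring the new copy of [m] next
    to the one in [ms], and the two merge. *)
Lemma tsum_absorb m ms :
  m \in ms -> teq (TAdd (tmonomial R m) (tsum ms)) (tsum ms).
Proof.
rewrite /tsum; elim: ms => [//|m' ms IH]; rewrite inE big_cons.
case/orP => [/eqP <-|/IH {2}<-]; first by rewrite teq_addA teq_addxx.
by rewrite !teq_addA (teq_addC (tmonomial R m)).
Qed.

Lemma tsum_sub ms1 ms2 :
  {subset ms1 <= ms2} -> teq (TAdd (tsum ms1) (tsum ms2)) (tsum ms2).
Proof.
elim: ms1 => [|m ms1 IH] sub; first by rewrite /tsum big_nil teq_add0.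
rewrite {1}/tsum big_cons -teq_addA IH.
  by apply: tsum_absorb; apply: sub; rewrite mem_head.
by move=> x xms; apply: sub; rewrite inE xms orbT.
Qed.

(** Each sum absorbs the other, so both equal their tropical sum. Hence only the support of a
    polynomial matters, not order or multiplicity. *)
Lemma tsum_eq_mem ms1 ms2 : ms1 =i ms2 -> teq (tsum ms1) (tsum ms2).
Proof.
move=> eq12; rewrite -(@tsum_sub ms2 ms1) => [|x]; last by rewrite eq12.
by rewrite teq_addC; apply: tsum_sub => x; rewrite eq12.
Qed.

Lemma teq_big_mul (I : Type) (r : seq I) (F G : I -> texpr) :
  teq (\big[@TMul R n/TOne R n]_(i <- r) TMul (F i) (G i))
      (TMul (\big[@TMul R n/TOne R n]_(i <- r) F i)
            (\big[@TMul R n/TOne R n]_(i <- r) G i)).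
Proof.
elim: r => [|i r IH]; first by rewrite !big_nil teq_mul1.
by rewrite !big_cons IH teq_mulACA.
Qed.

Lemma teq_big_mul_congr (I : Type) (r : seq I) (F G : I -> texpr) :
  (forall i, teq (F i) (G i)) ->
  teq (\big[@TMul R n/TOne R n]_(i <- r) F i)
      (\big[@TMul R n/TOne R n]_(i <- r) G i).
Proof.
move=> eqFG; elim: r => [|i r IH]; first by rewrite !big_nil.
by rewrite !big_cons IH eqFG.
Qed.

Lemma tmonomialD (m1 m2 : mon) :
  teq (tmonomial R (m1 + m2)%MM) (TMul (tmonomial R m1) (tmonomial R m2)).
Proof.
rewrite /tmonomial -teq_big_mul; apply: teq_big_mul_congr => i.
rewrite mnmDE; elim: (m1 i) => [|k IH] /=; first by rewrite teq_mul1.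
by rewrite IH teq_mulA.
Qed.

Lemma tmonomial0 : teq (tmonomial R (0%MM : mon)) (TOne R n).
Proof.
rewrite /tmonomial; elim: (index_enum _) => [|i r IH]; first by rewrite big_nil.
by rewrite big_cons IH mnm0E /= teq_mul1.
Qed.

(** The induction runs over any duplicate-free index list containing [i]: the factor at [i] is met
    once, and all others are empty products. *)
Lemma tmonomialU i : teq (tmonomial R (U_(i)%MM : mon)) (TVar R i).
Proof.
have tail r : i \notin r -> teq (\big[@TMul R n/TOne R n]_(k <- r)
    iter (U_(i)%MM k) (TMul (TVar R k)) (TOne R n)) (TOne R n).
  elim: r => [|k r IH]; first by rewrite big_nil.
  rewrite inE negb_or big_cons mnm1E => /andP[/negPf -> /IH ->] /=.
  by rewrite teq_mul1.
rewrite /tmonomial.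
have : i \in index_enum 'I_n by rewrite mem_index_enum.
have := index_enum_uniq 'I_n; elim: (index_enum _) => [//|j r IH] /=.
rewrite inE big_cons mnm1E => /andP[jr ur].
case: eqVneq jr => [<- /tail -> _|_ _] /=; first by rewrite !teq_mulr1.
by move=> /= /(IH ur) ->; rewrite teq_mul1.
Qed.

Lemma tsum0 : teq (tsum [::]) (TZero R n).
Proof. by rewrite /tsum big_nil. Qed.

Lemma tsum1 m : teq (tsum [:: m]) (tmonomial R m).
Proof. by rewrite /tsum big_cons big_nil teq_addr0. Qed.

Definition mulmon (ms1 ms2 : seq mon) : seq mon :=
  [seq (m1 + m2)%MM | m1 <- ms1, m2 <- ms2].

Lemma tsum_mulmon ms1 ms2 :
  teq (tsum (mulmon ms1 ms2)) (TMul (tsum ms1) (tsum ms2)).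
Proof.
elim: ms1 => [|m ms1 IH]; first by rewrite tsum0 teq_mul0.
have -> : tsum (m :: ms1) = TAdd (tmonomial R m) (tsum ms1).
  by rewrite /tsum big_cons.
rewrite /mulmon allpairs_cons tsum_cat IH teq_mulDl.
apply: teq_add; last by [].
elim: ms2 {IH} => [|m2 ms2 IH] /=; first by rewrite !tsum0 teq_mulr0.
by rewrite /tsum !big_cons teq_mulDr -tmonomialD -IH.
Qed.

End TropicalSums.

(** * Straight-line programs and gate counts *)

Section Circuits.

Variables (R : realType) (n : nat).
Local Notation texpr := (texpr R n).
Local Notation mon := 'X_{1..n}.
Local Notation gate := (gate R n).
Local Notation operand := (operand R n).

#[local] Existing Instance teq_equivalence.
#[local] Existing Instance TAdd_proper.
#[local] Existing Instance TMul_proper.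
#[local] Hint Resolve teq_refl : core.

(** This is the fold inside [res], isolated so that programs can be extended one gate at a time. *)
Definition gate_vals (P : seq gate) : seq texpr :=
  foldl (fun vals g => rcons vals (gate_res vals g)) [::] P.

Lemma gate_vals_rcons (P : seq gate) (g : gate) :
  gate_vals (rcons P g) = rcons (gate_vals P) (gate_res (gate_vals P) g).
Proof. by rewrite /gate_vals foldl_rcons. Qed.

Lemma size_gate_vals P : size (gate_vals P) = size P.
Proof.
elim/last_ind: P => [//|P g IH].
by rewrite gate_vals_rcons !size_rcons IH.
Qed.

Lemma gates_wf_rcons k (P : seq gate) (g : gate) :
  gates_wf k (rcons P g) = gates_wf k P && gate_before (k + size P) g.
Proof.
elim: P k => [|h P IH] k /=; first by rewrite addn0 andbT.
by rewrite IH addSnnS andbA.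
Qed.

(** The witness is an operand rather than a gate, so variables and constants are available at no
    cost. *)
Definition available (P : seq gate) (ms : seq mon) : Prop :=
  exists2 w : operand, operand_before (size P) w
    & teq (operand_res (gate_vals P) w) (tsum R ms).

Lemma available_rcons P g ms : available P ms -> available (rcons P g) ms.
Proof.
case=> w wP ew; exists w; first by
  case: w wP {ew} => //= k; rewrite size_rcons; lia.
rewrite gate_vals_rcons; case: w wP ew => //= k kP.
by rewrite nth_rcons size_gate_vals kP.
Qed.

Lemma available_gate P g ms :
  teq (gate_res (gate_vals P) g) (tsum R ms) -> available (rcons P g) ms.
Proof.
move=> eg; exists (OfGate R n (size P)); first by rewrite /= size_rcons.
by rewrite gate_vals_rcons /= nth_rcons size_gate_vals ltnn eqxx.
Qed.

Lemma available_mem P ms1 ms2 :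
  ms1 =i ms2 -> available P ms1 -> available P ms2.
Proof. by move=> /(tsum_eq_mem R) e [w wP ew]; exists w; rewrite -?e. Qed.

Lemma available_nil P : available P [::].
Proof. by exists (InConst n None); rewrite //= tsum0. Qed.

Lemma available_one P : available P [:: 0%MM].
Proof. by exists (InConst n (Some 0%R)); rewrite //= tsum1 tmonomial0. Qed.

Lemma available_var P i : available P [:: U_(i)%MM].
Proof. by exists (InVar R i); rewrite //= tsum1 tmonomialU. Qed.

(** A single program must provide every list of the family [L]; this records the sharing of
    intermediate results that the gate count depends on. *)
Definition computable (N : nat) (L : seq mon -> Prop) : Prop :=
  exists P, [/\ gates_wf 0 P, size P <= N & forall ms, L ms -> available P ms].

Lemma computable0 : computable 0 (fun ms => ms = [::] \/ ms = [:: 0%MM]).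
Proof.
exists [::]; split=> // ms [->|->]; [exact: available_nil|exact: available_one].
Qed.

Lemma computable_sub N N' (L L' : seq mon -> Prop) : N <= N' ->
    (forall ms', L' ms' -> exists2 ms, L ms & ms =i ms') ->
  computable N L -> computable N' L'.
Proof.
move=> NN' LL' [P [wfP sP avP]]; exists P; split=> //.
  exact: leq_trans NN'.
by move=> ms /LL' [ms' /avP av /available_mem]; apply.
Qed.

(** The new gate may depend on the program [P], because the operands holding the lists of [L] are
    known only once [P] is given. *)
Lemma computable_gate N (L : seq mon -> Prop) ms :
    (forall P, gates_wf 0 P -> (forall ms', L ms' -> available P ms') ->
       exists2 g, gate_before (size P) g
                & teq (gate_res (gate_vals P) g) (tsum R ms)) ->
  computable N L -> computable N.+1 (fun ms' => L ms' \/ ms' = ms).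
Proof.
move=> Hg [P [wfP sP avP]]; have [g gP eg] := Hg P wfP avP.
exists (rcons P g); split; first by rewrite gates_wf_rcons wfP.
  by rewrite size_rcons.
by move=> ms' [/avP /available_rcons|->]; last exact: available_gate.
Qed.

Lemma computable_add N (L : seq mon -> Prop) ms1 ms2 : L ms1 -> L ms2 ->
  computable N L -> computable N.+1 (fun ms => L ms \/ ms = ms1 ++ ms2).
Proof.
move=> L1 L2; apply: computable_gate => P _ avP.
have [w1 wP1 e1] := avP _ L1; have [w2 wP2 e2] := avP _ L2.
by exists (GAdd w1 w2); rewrite /= ?wP1 // e1 e2 tsum_cat.
Qed.

Lemma computable_mul N (L : seq mon -> Prop) ms1 ms2 : L ms1 -> L ms2 ->
  computable N L -> computable N.+1 (fun ms => L ms \/ ms = mulmon ms1 ms2).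
Proof.
move=> L1 L2; apply: computable_gate => P _ avP.
have [w1 wP1 e1] := avP _ L1; have [w2 wP2 e2] := avP _ L2.
by exists (GMul w1 w2); rewrite /= ?wP1 // e1 e2 tsum_mulmon.
Qed.

(** The variable is read directly as an input operand, so it need not belong to [L]. *)
Lemma computable_mulU N (L : seq mon -> Prop) i ms : L ms ->
  computable N L ->
  computable N.+1 (fun ms' => L ms' \/ ms' = mulmon [:: U_(i)%MM] ms).
Proof.
move=> Lms; apply: computable_gate => P _ avP.
have [w1 wP1 e1] := available_var P i; have [w2 wP2 e2] := avP _ Lms.
by exists (GMul w1 w2); rewrite /= ?wP1 // e1 e2 tsum_mulmon.
Qed.

Lemma computable_circuit N (L : seq mon -> Prop) ms : L ms -> computable N L ->
  exists2 C : circuit R n, evaluates C (tsum R ms) & num_gates C <= N.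
Proof.
move=> Lms [P [wfP sP /(_ ms Lms)[w wP ew]]].
have wf : gates_wf 0 P && operand_before (size P) w by rewrite wfP.
by exists (Circuit wf).
Qed.

(** One evaluating circuit makes the set of attainable gate counts nonempty; its least element,
    found by well-ordering, is the complexity. *)
Lemma tropical_complexity_le (C : circuit R n) (g : texpr) N :
  evaluates C g -> num_gates C <= N ->
  exists k, tropical_complexity g k /\ k <= N.
Proof.
move=> eC CN.
pose p k := `[< exists2 C, evaluates C g & num_gates C = k >].
have exp : exists k, p k by exists (num_gates C); apply/asboolP; exists C.
case: (ex_minnP exp) => k /asboolP kC kmin; exists k; split.
  by split=> // C' eC'; apply: kmin; apply/asboolP; exists C'.
by apply: leq_trans CN; apply: kmin; apply/asboolP; exists C.
Qed.

(** * Circuits for elementary symmetric polynomials and their products *)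

Fixpoint esym_mons (s : seq 'I_n) (k : nat) : seq mon :=
  match s, k with
  | _, 0 => [:: 0%MM]
  | [::], _.+1 => [::]
  | i :: s', k'.+1 => esym_mons s' k ++ mulmon [:: U_(i)%MM] (esym_mons s' k')
  end.

Lemma esym_mons0 s : esym_mons s 0 = [:: 0%MM].
Proof. by case: s. Qed.

(** Each degree from 1 to [k] costs two gates, a multiplication by the variable [i] and an addition.
    Degree 0 is free since [e_0] is the same list for [s] and [i :: s]. *)
Lemma computable_esym_step N (L : seq mon -> Prop) K i s k :
    (forall k', k' <= K -> L (esym_mons s k')) -> k <= K -> computable N L ->
  computable (N + 2 * k)
    (fun ms => L ms \/ exists2 k', k' <= k & ms = esym_mons (i :: s) k').
Proof.
move=> Ls; elim: k => [|k IH] kK cL.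
  apply: computable_sub cL; first by rewrite addn0.
  move=> ms [Lms|[k']]; first by exists ms.
  rewrite leqn0 => /eqP -> ->; exists (esym_mons s 0); first exact: Ls.
  by rewrite !esym_mons0.
have {IH} := IH (ltnW kK) cL.
move=> /(@computable_mulU _ _ i (esym_mons s k) (or_introl (Ls k (ltnW kK)))).
move=> /(@computable_add _ _ (esym_mons s k.+1)
          (mulmon [:: U_(i)%MM] (esym_mons s k))
          (or_introl (or_introl (Ls k.+1 kK))) (or_intror erefl)).
apply: computable_sub; first by lia.
move=> ms [Lms|[k']]; first by exists ms => //; do 3!left.
rewrite leq_eqVlt => /orP[/eqP -> ->|k'k ->].
  by exists (esym_mons (i :: s) k.+1) => //; right.
by exists (esym_mons (i :: s) k') => //; left; left; right; exists k'.
Qed.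

Lemma esym_mons_oversize s k : size s < k -> esym_mons s k = [::].
Proof.
elim: s k => [|i s IH] [|k] //= sk; rewrite !IH //; exact: ltnW.
Qed.

Lemma computable_esym K s :
  computable (2 * K * size s)
    (fun ms => exists2 k, k <= K & ms = esym_mons s k).
Proof.
elim: s => [|i s IH].
  apply: computable_sub computable0; first by rewrite muln0.
  by move=> ms [[|k] _ ->]; [exists [:: 0%MM]|exists [::]] => //; [right|left].
have Ls k' : k' <= K -> exists2 k, k <= K & esym_mons s k' = esym_mons s k.
  by move=> k'K; exists k'.
have := @computable_esym_step _ _ K i s K Ls (leqnn K) IH.
apply: computable_sub; first by rewrite /= mulnS addnC.
by move=> ms [k kK ->]; exists (esym_mons (i :: s) k) => //; right; exists k.
Qed.

Definition esym_prod_mons (cs : seq nat) : seq mon :=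
  foldr (fun c ms => mulmon (esym_mons (enum 'I_n) c) ms) [:: 0%MM] cs.

(** The induction keeps all [e_k] with [k <= n] at hand, so each further factor costs one
    multiplication. *)
Lemma computable_esym_prod cs :
  computable (2 * n * n + size cs) (eq (esym_prod_mons cs)).
Proof.
(* The empty list is kept in the family to serve as [e_c] when [c] exceeds [n]. *)
suff : computable (2 * n * n + size cs) (fun ms =>
    (exists2 k, k <= n & ms = esym_mons (enum 'I_n) k)
      \/ ms = esym_prod_mons cs \/ ms = [::]).
  apply: computable_sub => // ms <-.
  by exists (esym_prod_mons cs) => //; right; left.
elim: cs => [|c cs IH] /=.
  have := computable_esym n (enum 'I_n).
  rewrite size_enum_ord => -[P [wfP sP avP]]; exists P; split=> //.
    by rewrite addn0.
  move=> ms [[k kn ->]|[->|->]]; first by apply: avP; exists k.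
  - exact: available_one.
  - exact: available_nil.
rewrite addnS.
set ec := esym_mons (enum 'I_n) c.
have Lc : (exists2 k, k <= n & ec = esym_mons (enum 'I_n) k)
    \/ ec = esym_prod_mons cs \/ ec = [::].
  case: (leqP c n) => cn; first by left; exists c.
  by right; right; rewrite /ec esym_mons_oversize // size_enum_ord.
move/(computable_mul Lc (or_intror (or_introl erefl))): IH.
apply: computable_sub => // ms [Lms|[->|->]].
- by exists ms => //; left; left.
- by exists (mulmon ec (esym_prod_mons cs)) => //; right.
- by exists [::] => //; left; right; right.
Qed.

End Circuits.

(** * Supports of products of elementary symmetric polynomials *)

Section Monomials.

Variable n : nat.

(** The two branches of the recursion separate the subsets [A] that avoid the head of [s] from those
    that contain it; [uniq s] keeps the monomials squarefree. *)
Lemma mem_esym_mons (s : seq 'I_n) k m : uniq s ->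
  reflect (exists A : {set 'I_n}, [/\ {subset A <= s}, #|A| = k & m = mesym1 A])
          (m \in esym_mons s k).
Proof.
move=> us; apply: (iffP idP).
  elim: s us k m => [|i s IH] /= us [|k] m; rewrite ?inE //.
  - move=> /eqP ->; exists set0; split; rewrite ?cards0 //.
      by move=> x; rewrite inE.
    by apply/mnmP => j; rewrite mnm0E mnmE inE.
  - move=> /eqP ->; exists set0; split; rewrite ?cards0 //.
      by move=> x; rewrite inE.
    by apply/mnmP => j; rewrite mnm0E mnmE inE.
  case/andP: us => is_ us; rewrite mem_cat => /orP[/(IH us) [A [As <- ->]]|].
    by exists A; split=> // x /As; rewrite inE orbC => ->.
  case/allpairsP=> -[m1 m2] /= [+ /(IH us) [A [As <- ->]] ->].
  rewrite inE => /eqP ->.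
  have iA : i \notin A by apply/negP => /As; rewrite (negPf is_).
  exists (i |: A); split; rewrite ?cardsU1 ?iA //.
    by move=> x /setU1P[->|/As]; rewrite inE ?eqxx // => ->; rewrite orbT.
  apply/mnmP => j; rewrite mnmDE mnm1E !mnmE in_setU1 eq_sym.
  by case: eqVneq => [->|//]; rewrite (negPf iA).
elim: s us k m => [|i s IH] /= us [|k] m [A [As Ak ->]].
- move/eqP: Ak; rewrite cards_eq0 => /eqP ->; rewrite inE; apply/eqP/mnmP => j.
  by rewrite mnm0E mnmE inE.
- by have /card_gt0P[x /As] : 0 < #|A| by rewrite Ak.
- move/eqP: Ak; rewrite cards_eq0 => /eqP ->; rewrite inE; apply/eqP/mnmP => j.
  by rewrite mnm0E mnmE inE.
case/andP: us => is_ us; rewrite mem_cat; apply/orP.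
case: (boolP (i \in A)) => iA.
  right; apply/allpairsP; exists (U_(i), mesym1 (A :\ i))%MM.
  split; rewrite ?inE //=.
    apply: IH => //; exists (A :\ i); split=> //.
      by move=> x /setD1P[xi /As]; rewrite inE (negPf xi).
    by apply: succn_inj; rewrite -Ak (cardsD1 i A) iA.
  apply/mnmP => j; rewrite mnmDE mnm1E !mnmE in_setD1 eq_sym.
  by case: eqVneq => [->|//]; rewrite iA.
left; apply: IH => //; exists A; split=> // x xA; have := As x xA.
by rewrite inE => /orP[/eqP xi|//]; rewrite xi (negPf iA) in xA.
Qed.

(** One subset is chosen per factor; as [r] has no duplicates, the choice at the head can override
    [S] without disturbing the tail. *)
Lemma mem_esym_prod_mons (J : eqType) (r : seq J) (c : J -> nat) m : uniq r ->
  m \in esym_prod_mons n [seq c j | j <- r] <->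
  exists2 S : J -> {set 'I_n}, (forall j, j \in r -> #|S j| = c j)
    & m = (\sum_(j <- r) mesym1 (S j))%MM.
Proof.
elim: r m => [|j r IH] m /=.
  rewrite inE => _; split => [/eqP ->|[S _ ->]]; last by rewrite big_nil.
  by exists (fun=> set0) => //; rewrite big_nil.
case/andP=> jr ur; split.
  case/allpairsP => -[m1 m2] /= [/mem_esym_mons]; rewrite enum_uniq.
  case=> // A [_ Ac ->] /(IH _ ur)[S Sc ->] ->.
  exists (fun j' => if j' == j then A else S j').
    move=> j'; rewrite inE; case: eqP => [->|_] //=; exact: Sc.
  rewrite big_cons eqxx; congr (_ + _)%MM.
  rewrite !big_seq; apply: eq_bigr => j' j'r; case: eqP => // jj.
  by rewrite -jj j'r in jr.
case=> S Sc ->; rewrite big_cons.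
apply/allpairsP; exists (mesym1 (S j), \sum_(j <- r) mesym1 (S j))%MM.
split=> //=.
  apply/mem_esym_mons; first exact: enum_uniq.
  exists (S j); split=> //; first by move=> x; rewrite mem_enum.
  by apply: Sc; rewrite mem_head.
by apply/IH => //; exists S => // j' j'r; apply: Sc; rewrite inE j'r orbT.
Qed.

Lemma sum_pairs (J : finType) (P : {set J * 'I_n}) (F : J * 'I_n -> nat) :
  \sum_(p in P) F p = \sum_j \sum_(x | (j, x) \in P) F (j, x).
Proof. by rewrite pair_big_dep /=; apply: eq_big => [[j x]|[j x]]. Qed.

Lemma sum_column (J : finType) (P : {set J * 'I_n}) j :
  \sum_(p in P) (p.1 == j) = #|[set x | (j, x) \in P]|.
Proof.
rewrite sum_pairs (bigD1 j) //= [X in _ + X]big1 => [|j' /negPf jj].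
  by rewrite addn0 -sum1_card; apply: eq_big => x; rewrite ?inE ?eqxx.
by rewrite big1 // => x _; rewrite jj.
Qed.

(** The family of subsets is merged into one set of pairs, and both conditions become sums over it,
    the form in which [sum_swap] tracks an exchange between columns. *)
Lemma mem_esym_prod_pairs (J : finType) (c : J -> nat) m :
  m \in esym_prod_mons n [seq c j | j <- enum J] <->
  exists P : {set J * 'I_n}, (forall j, \sum_(p in P) (p.1 == j) = c j)
    /\ (forall i, m i = \sum_(p in P) (p.2 == i)).
Proof.
pose col_set (P : {set J * 'I_n}) j := [set x | (j, x) \in P].
have content (P : {set J * 'I_n}) i : \sum_(p in P) (p.2 == i) =
    (\sum_(j <- enum J) mesym1 (col_set P j))%MM i.
  rewrite mnm_sumE big_enum /= sum_pairs; apply: eq_bigr => j _.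
  rewrite big_mkcond (bigD1 i) //= big1 ?addn0 => [|x /negPf xi].
    by rewrite eqxx mnmE inE; case: ifP.
  by rewrite xi; case: ifP.
rewrite mem_esym_prod_mons ?enum_uniq //; split=> [[S Sc ->]|[P [Pc mP]]].
  pose P := [set p : J * 'I_n | p.2 \in S p.1].
  have PS j : col_set P j = S j by apply/setP => x; rewrite !inE.
  exists P; split=> [j|i]; first by rewrite sum_column -(Sc j) ?mem_enum // -PS.
  rewrite content; congr (fun_of_multinom _ i).
  by apply: eq_bigr => j _; rewrite PS.
exists (col_set P) => [j _|]; first by rewrite -sum_column.
by apply/mnmP => i; rewrite mP content.
Qed.

End Monomials.

(** * Column-strict fillings and exchanges between columns *)

Section Tableaux.

Variables (n : nat) (la mu : seq nat).
Local Notation box := (skew_box la mu).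
Local Notation filling := (filling n la mu).
Local Notation column := 'I_(first_part la).

Definition column_strict (T : filling) : Prop :=
  forall b b', box_col b = box_col b' -> box_row b < box_row b' -> T b < T b'.

Definition bcol (b : box) : column := (val b).2.

Definition column_length (j : column) : nat := #|[set b : box | bcol b == j]|.

(** Rows are forgotten: strictness forces the order of the values within each column. *)
Definition entries (T : filling) : {set column * 'I_n} :=
  [set (bcol b, T b) | b : box].

Lemma box_inj (b b' : box) :
  box_row b = box_row b' -> box_col b = box_col b' -> b = b'.
Proof.
move=> er ec; apply: val_inj; move: er ec; rewrite /box_row /box_col.
by case: (val b) (val b') => [r c] [r' c'] /= /val_inj -> /val_inj ->.
Qed.

Lemma column_strict_inj T b b' : column_strict T ->
  box_col b = box_col b' -> T b = T b' -> b = b'.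
Proof.
move=> csT ec eT; apply: box_inj => //.
case: (ltngtP (box_row b) (box_row b')) => //
  [/(csT _ _ ec)|/(csT _ _ (esym ec))];
  by rewrite eT ltnn.
Qed.

Lemma column_strict_lt T b b' : column_strict T ->
  box_col b = box_col b' -> (T b < T b') = (box_row b < box_row b').
Proof.
move=> csT ec.
case: (ltngtP (box_row b) (box_row b')) => [/csT -> //|/csT lt|er].
  by apply/negbTE; rewrite -leqNgt ltnW // lt.
by rewrite (box_inj er ec) ltnn.
Qed.

Lemma sum_entries T (F : column * 'I_n -> nat) : column_strict T ->
  \sum_(p in entries T) F p = \sum_b F (bcol b, T b).
Proof.
move=> csT; rewrite big_imset /=; first by apply: eq_bigl => b; rewrite inE.
by move=> b b' _ _ [/(congr1 val) ec /(column_strict_inj csT ec)].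
Qed.

Lemma column_lengthE j : column_length j = \sum_(b : box) (bcol b == j).
Proof.
rewrite /column_length -sum1_card big_mkcond.
by apply: eq_bigr => b _; rewrite inE.
Qed.

(* The [k]-th smallest entry prescribed for a column goes into its [k]-th box. *)
Lemma exists_filling (P : {set column * 'I_n}) :
    (forall j, \sum_(p in P) (p.1 == j) = column_length j) ->
  exists2 T, column_strict T & entries T = P.
Proof.
move=> Pc; pose S j := [set x : 'I_n | (j, x) \in P].
pose above (b : box) :=
  [set b' : box | (bcol b' == bcol b) && (box_row b' < box_row b)].
have cS j : #|S j| = column_length j.
  by rewrite -Pc sum_column.
have rank_lt b : #|above b| < #|S (bcol b)|.
  rewrite cS; apply/proper_card/properP; split.
    by apply/subsetP => b'; rewrite !inE => /andP[].
  by exists b; rewrite !inE ?eqxx ?ltnn.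
(* A default for [nth] has to be built from a box, since ['I_n] is empty when [n] is 0. *)
have x0 (b : box) : 'I_n.
  have : 0 < #|S (bcol b)| by apply: leq_ltn_trans (rank_lt b).
  by rewrite cardE; case: (enum _).
pose T : filling := [ffun b => nth (x0 b) (enum (S (bcol b))) #|above b|].
have T_S b : T b \in S (bcol b).
  by rewrite ffunE -mem_enum mem_nth // -cardE.
have csT : column_strict T.
  move=> b b' ec rlt; have {ec} ec : bcol b = bcol b' by apply: val_inj.
  have lt_above : #|above b| < #|above b'|.
    apply/proper_card/properP; split.
      apply/subsetP => b2; rewrite !inE ec => /andP[-> /= /ltn_trans]; exact.
    by exists b; rewrite !inE ?ec ?eqxx ?ltnn.
  (* The two defaults differ, but both ranks are in range, so one default can replace the other
     before comparing positions in a sorted list. *)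
  rewrite !ffunE ec (set_nth_default (x0 b')) -?cardE; last first.
    by rewrite -ec; apply: rank_lt.
  have sortedS (A : {set 'I_n}) : sorted (fun x y : 'I_n => x < y) (enum A).
    rewrite {1}/enum_mem sorted_filter //.
      by move=> x y z; apply: ltn_trans.
    rewrite -enumT; have := iota_ltn_sorted 0 n.
    by rewrite -val_enum_ord sorted_map.
  apply: (sorted_ltn_nth _ (x0 b') (sortedS (S (bcol b')))) => //.
  - by move=> x y z; apply: ltn_trans.
  - by rewrite inE -cardE -ec rank_lt.
  - by rewrite inE -cardE rank_lt.
exists T => //; apply/eqP; rewrite eqEcard; apply/andP; split.
  by apply/subsetP => _ /imsetP[b _ ->]; have := T_S b; rewrite inE.
(* One inclusion is known; the sets agree because their cardinalities do, column by column. *)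
have total (Q : {set column * 'I_n}) : #|Q| = \sum_j \sum_(p in Q) (p.1 == j).
  rewrite exchange_big /= -sum1_card; apply: eq_bigr => p _.
  by rewrite (bigD1 p.1) //= eqxx big1 // => j /negPf; rewrite eq_sym => ->.
rewrite !total leq_eqVlt; apply/orP; left; apply/eqP; apply: eq_bigr => j _.
by rewrite Pc sum_entries // column_lengthE.
Qed.

(** The values [u] and [v] trade columns. An arbitrary [F] covers column sizes, contents and the
    weight at once, and the additive form avoids subtraction in [nat]. *)
Lemma sum_swap (J : finType) (P : {set J * 'I_n}) j j' u v :
    (j, u) \in P -> (j', v) \in P -> (j, v) \notin P -> (j', u) \notin P ->
  exists P' : {set J * 'I_n}, forall F : J * 'I_n -> nat,
    \sum_(p in P') F p + F (j, u) + F (j', v) =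
    \sum_(p in P) F p + F (j, v) + F (j', u).
Proof.
move=> juP jvP njv nju.
have uv : u != v by apply: contraNneq njv => <-.
have jj' : j != j' by apply: contraNneq nju => <-.
exists ((j, v) |: ((j', u) |: (P :\ (j, u) :\ (j', v)))) => F.
rewrite big_setU1 /=; last first.
  by rewrite !inE (negPf njv) !xpair_eqE (negPf jj') !andbF.
rewrite big_setU1 /=; last by rewrite !inE (negPf nju) !andbF.
rewrite (big_setD1 _ juP) /= [in RHS](big_setD1 (j', v)) /=; last first.
  by rewrite !inE jvP !xpair_eqE eq_sym (negPf jj').
set sum := \sum_(p in _) F p; move: sum (F _) (F _) (F _) (F _); lia.
Qed.

(** Pigeonhole: the image of [D'] is too small to contain the injective image of [D]. *)
Lemma fewer_entries_missing (T : filling) (D D' : {set box}) :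
  {in D &, injective T} ->
  #|D'| < #|D| -> exists2 d, d \in D & forall d', d' \in D' -> T d' != T d.
Proof.
move=> injT lt; case: (boolP (T @: D \subset T @: D')) => [sub|].
  have := subset_leq_card sub; rewrite (card_in_imset injT) => le.
  by have := leq_trans le (leq_imset_card T _); rewrite leqNgt lt.
case/subsetPn => _ /imsetP[d dD ->] nd; exists d => // d' d'D.
by apply: contraNneq nd => <-; apply: imset_f.
Qed.

Hypothesis shape : skew_shape la mu.

Lemma partition_nth_le (nu : seq nat) i i' :
  is_partition nu -> i <= i' -> nth 0 nu i' <= nth 0 nu i.
Proof.
case/andP=> snu _ ii'.
case: (ltnP i' (size nu)) => [lt|?]; last by rewrite nth_default.
apply: (sorted_leq_nth _ _ 0 snu) => //; rewrite ?inE //.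
- by move=> x y z /= xy zx; apply: leq_trans xy.
- by move=> x; apply: leqnn.
- exact: leq_ltn_trans ii' lt.
Qed.

Lemma box_bounds (b : box) :
  nth 0 mu (box_row b) <= box_col b < nth 0 la (box_row b).
Proof. exact: (valP b). Qed.

Lemma box_exists (r : 'I_(size la)) (j : column) :
  nth 0 mu r <= j < nth 0 la r -> exists2 b : box, box_row b = r & bcol b = j.
Proof.
by move=> h; have h' : in_skew mu (r, j) by []; exists (exist _ (r, j) h').
Qed.

(** Boxes of [D'] share a column, so rows count them; these rows all occur in [D], which also has
    the row of [d0]. *)
Lemma card_lt_rows (D D' : {set box}) j' d0 :
    {in D', forall d, bcol d = j'} -> d0 \in D ->
    {in D', forall d, box_row d <> box_row d0} ->
    {in D', forall d, exists2 e, e \in D & box_row e = box_row d} ->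
  #|D'| < #|D|.
Proof.
move=> D'j d0D nd0 lift; pose row (b : box) := (val b).1.
have injD' : {in D' &, injective row}.
  move=> d e /D'j dj /D'j ej de; apply: box_inj.
    by rewrite /box_row -!/(row _) de.
  by rewrite /box_col -!/(bcol _) dj ej.
rewrite -(card_in_imset injD'); apply: leq_trans (leq_imset_card row D).
apply/proper_card/properP; split.
  apply/subsetP => _ /imsetP[d /lift[e eD] ed ->]; apply/imsetP; exists e => //.
  exact: val_inj.
exists (row d0); first exact: imset_f.
by apply/imsetP => -[d /nd0 nd /(congr1 val) /esym].
Qed.

(* Row convexity of a skew shape makes the part of the left column weakly below
   the row of [b] longer than the part of the right column strictly below it,
   and symmetrically above; so some entry [u >= T b] can be moved to the right
   and some entry [v <= T b'] to the left. *)
Lemma exists_swap (T : filling) (b b' : box) : column_strict T ->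
    box_row b = box_row b' -> box_col b < box_col b' -> T b' < T b ->
  exists u v : 'I_n, [/\ v < u, (bcol b, u) \in entries T,
    (bcol b', v) \in entries T, (bcol b, v) \notin entries T
    & (bcol b', u) \notin entries T].
Proof.
move=> csT er lc lT; have [pla pmu _] := shape.
have [/andP[bmu bla] /andP[b'mu b'la]] := (box_bounds b, box_bounds b').
pose below := [set d : box | (bcol d == bcol b) && (box_row b <= box_row d)].
pose below' := [set d : box | (bcol d == bcol b') && (box_row b' < box_row d)].
pose above := [set d : box | (bcol d == bcol b) && (box_row d < box_row b)].
pose above' := [set d : box | (bcol d == bcol b') && (box_row d <= box_row b')].
have lt_below : #|below'| < #|below|.
  apply: (@card_lt_rows below below' (bcol b') b).
  - by move=> d; rewrite inE => /andP[/eqP].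
  - by rewrite inE eqxx leqnn.
  - by move=> d; rewrite inE -er => /andP[_ lt] eq; rewrite eq ltnn in lt.
  move=> d; rewrite inE => /andP[/eqP/(congr1 val) dc lt].
  have /andP[dmu dla] := box_bounds d.
  (* The bound by [mu] passes down from the row of [b]; the bound by [la] comes from [d], which lies
     further right in the same row. *)
  have [|e ed ec] := @box_exists (val d).1 (bcol b).
    apply/andP; split.
      apply: leq_trans bmu; apply: partition_nth_le => //.
      by rewrite er; apply: ltnW.
    by apply: leq_trans dla; rewrite ltnS [box_col d]dc; apply: ltnW.
  by exists e => //; rewrite inE ec eqxx ed /= er; apply: ltnW.
have lt_above : #|above| < #|above'|.
  apply: (@card_lt_rows above' above (bcol b) b').
  - by move=> d; rewrite inE => /andP[/eqP].
  - by rewrite inE eqxx leqnn.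
  - by move=> d; rewrite inE -er => /andP[_ lt] eq; rewrite eq ltnn in lt.
  move=> d; rewrite inE => /andP[/eqP/(congr1 val) dc lt].
  have /andP[dmu dla] := box_bounds d.
  (* Symmetrically, the bound by [mu] comes from [d], further left, and the bound by [la] passes up
     from the row of [b']. *)
  have [|e ed ec] := @box_exists (val d).1 (bcol b').
    apply/andP; split.
      by apply: leq_trans dmu _; rewrite [box_col d]dc; apply: ltnW.
    apply: leq_trans b'la _; apply: partition_nth_le => //.
    by rewrite -er; apply: ltnW.
  by exists e => //; rewrite inE ec eqxx ed /= -er; apply: ltnW.
have inj_col (D : {set box}) j :
    {in D, forall d, bcol d = j} -> {in D &, injective T}.
  move=> Dj d e /Dj dj /Dj ej; apply: column_strict_inj => //.
  by rewrite /box_col -!/(bcol _) dj ej.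
have same_col d e : bcol d = bcol e -> box_col d = box_col e.
  by move/(congr1 val).
have [|d dD nd] := @fewer_entries_missing T below below' _ lt_below.
  by apply: (@inj_col _ (bcol b)) => d; rewrite inE => /andP[/eqP].
have [|e eD ne] := @fewer_entries_missing T above' above _ lt_above.
  by apply: (@inj_col _ (bcol b')) => e; rewrite inE => /andP[/eqP].
move: dD eD; rewrite !inE => /andP[/eqP dc dr] /andP[/eqP ec er'].
have leTd : T b <= T d.
  by rewrite leqNgt (column_strict_lt csT (same_col _ _ dc)) -leqNgt.
have leTe : T e <= T b'.
  by rewrite leqNgt (column_strict_lt csT (esym (same_col _ _ ec))) -leqNgt.
(* The chain is [T e <= T b' < T b <= T d]. *)
exists (T d), (T e); split.
- exact: leq_ltn_trans leTe (leq_trans lT leTd).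
- by apply/imsetP; exists d; rewrite ?dc.
- by apply/imsetP; exists e; rewrite ?ec.
(* A box [f] in the column of [b] with value [T e < T b] would lie above [b], where that value is
   missing by choice of [e]. *)
- apply/imsetP => -[f _ [fc fT]]; have : f \in above.
    rewrite inE -fc eqxx /= -(column_strict_lt csT (same_col _ _ (esym fc))) -fT.
    exact: leq_ltn_trans leTe lT.
  by move/ne; rewrite fT eqxx.
- apply/imsetP => -[f _ [fc fT]]; have : f \in below'.
    rewrite inE -fc eqxx /= -(column_strict_lt csT (same_col _ _ fc)) -fT.
    exact: leq_trans lT leTd.
  by move/nd; rewrite fT eqxx.
Qed.

(** * Semistandard tableaux of given content and the support of the skew Schur polynomial *)

Definition content (T : filling) (i : 'I_n) : nat := \sum_b (T b == i).

Lemma semistandard_column_strict (T : filling) :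
  semistandard T -> column_strict T.
Proof.
move=> /forallP ssT b b' /eqP ec lt; have /forallP/(_ b')/andP[_] := ssT b.
by rewrite ec lt.
Qed.

Lemma exists_semistandard (T : filling) : column_strict T ->
  exists2 T' : filling, semistandard T' & content T' =1 content T.
Proof.
move=> csT; pose weight (T : filling) := \sum_b bcol b * T b.
pose p T' := `[< column_strict T' /\ content T' =1 content T >].
have pT : p T by apply/asboolP.
case: (@arg_maxnP _ T p weight pT) => T' /asboolP[csT' cT'] maxT'.
exists T' => //; apply/forallP => b; apply/forallP => b'; apply/andP; split.
  apply/implyP => /andP[/eqP er lc]; rewrite leqNgt; apply/negP => lT.
  have [u [v [vu bu b'v nbv nb'u]]] := exists_swap csT' er lc lT.
  have [P sumP] := sum_swap bu b'v nbv nb'u.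
  (* The exchange keeps all column sizes, so re-sorting each column yields a column-strict filling
     again. *)
  have [j|T2 csT2 eT2] := @exists_filling P.
    rewrite column_lengthE -(@sum_entries T' (fun p => p.1 == j)) //.
    by have /= /addIn/addIn := sumP (fun p => p.1 == j).
  suff /maxT' : p T2.
    pose F (q : column * 'I_n) : nat := q.1 * q.2.
    rewrite /weight -(@sum_entries T2 F) // -(@sum_entries T' F) // eT2.
    have := sumP F; set x := \sum_(q in P) F q.
    set y := \sum_(q in entries T') F q.
    (* The weight grows by the column distance times [u - v], which is positive, against
       maximality. *)
    by move: x y lc vu; rewrite /F /bcol /box_col /= => x y; nia.
  apply/asboolP; split=> // i; rewrite -cT' /content.
  rewrite -(@sum_entries T2 (fun p => p.2 == i)) //.
  rewrite -(@sum_entries T' (fun p => p.2 == i)) // eT2.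
  by have /= := sumP (fun p => p.2 == i); rewrite addnAC => /addIn/addIn.
by apply/implyP => /andP[/eqP ec lr]; apply: csT'.
Qed.

(** Every coefficient is a sum of zeros and ones in an ordered ring, so no cancellation occurs and
    one tableau of content [m] suffices. *)
Lemma mem_msupp_skew_schur (K : numDomainType) (m : 'X_{1..n}) :
  m \in msupp (skew_schur n la mu K) <->
  exists2 T : filling, semistandard T & forall i, m i = content T i.
Proof.
have -> : skew_schur n la mu K =
    (\sum_(T : filling | semistandard T) 'X_[[multinom content T i | i < n]])%R.
  apply: eq_bigr => T _; rewrite mpolyXE_id; apply: eq_bigr => i _.
  rewrite mnmE; congr (_ ^+ _)%R; rewrite -sum1_card big_mkcond.
  by apply: eq_bigr => b _; rewrite inE.
rewrite mcoeff_msupp raddf_sum /= psumr_neq0 => [|T _]; last first.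
  by rewrite mcoeffX ler0n.
split=> [/hasP[T _ /andP[ssT]]|[T ssT mT]].
  by rewrite mcoeffX ltr0n lt0b => /eqP <-; exists T => // i; rewrite mnmE.
apply/hasP; exists T; first exact: mem_index_enum.
rewrite ssT mcoeffX ltr0n lt0b; apply/eqP/mnmP => i.
by rewrite mnmE mT.
Qed.

Lemma msupp_skew_schur (K : numDomainType) :
  msupp (skew_schur n la mu K) =i
  esym_prod_mons n [seq column_length j | j <- enum column].
Proof.
move=> m; apply/idP/idP.
  move/mem_msupp_skew_schur => [T /semistandard_column_strict csT mT].
  apply/mem_esym_prod_pairs; exists (entries T); split=> [j|i].
    by rewrite sum_entries // column_lengthE.
  by rewrite mT sum_entries.
move/mem_esym_prod_pairs => [P [Pc mP]]; apply/mem_msupp_skew_schur.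
have [T csT eT] := exists_filling Pc.
have [T' ssT' cT'] := exists_semistandard csT.
by exists T' => // i; rewrite mP cT' -eT sum_entries.
Qed.

End Tableaux.

Theorem corollary1p5 (R : realType) :
  exists A : nat, forall (n : nat) (la mu : seq nat),
    skew_shape la mu ->
    exists k : nat,
      tropical_complexity (Trop R (skew_schur n la mu R[i])) k /\
      (k <= A * (n ^ 2 * first_part la))%N.
Proof.
(* For [n] and the first part both positive, [2 * n * n] and the first part are bounded by twice and
   once their product [n ^ 2 * first_part la]. *)
exists 3 => n la mu shape; set f := skew_schur n la mu R[i].
suff [N NA [L Lf cL]] : exists2 N, N <= 3 * (n ^ 2 * first_part la) &
    exists2 L : seq 'X_{1..n} -> Prop, L (msupp f) & computable R N L.
  have [C eC CN] := computable_circuit Lf cL.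
  exact: tropical_complexity_le eC (leq_trans CN NA).
pose cs := [seq @column_length la mu j | j <- enum 'I_(first_part la)].
have ef : msupp f =i esym_prod_mons n cs by apply: msupp_skew_schur.
(* Here the bound is 0, so no gate is allowed; the only exponent is 0, and the result is a
   constant. *)
have [n0|n0] := posnP n.
  exists 0 => //; exists (eq (msupp f)) => //.
  apply: computable_sub (computable0 R n) => // _ <-.
  have m0 (m : 'X_{1..n}) : m = 0%MM.
    by apply/mnmP => i; have := ltn_ord i; rewrite {2}n0.
  case: (msupp f) => [|m ms]; first by exists [::] => //; left.
  exists [:: 0%MM]; first by right.
  by move=> x; rewrite (m0 x) (m0 m) !inE eqxx.
(* Again no gate is allowed; there are no columns, and the empty product is the constant one. *)
have [l0|l0] := posnP (first_part la).
  exists 0 => //; exists (eq (msupp f)) => //.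
  apply: computable_sub (computable0 R n) => // _ <-.
  have cs0 : cs = [::] by apply: size0nil; rewrite size_map size_enum_ord.
  exists [:: 0%MM]; first by right.
  by move=> x; rewrite ef cs0.
exists (2 * n * n + size cs).
  by rewrite size_map size_enum_ord; nia.
exists (eq (msupp f)) => //.
apply: computable_sub (computable_esym_prod R n cs) => // _ <-.
by exists (esym_prod_mons n cs).
Qed.
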